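(* Let $A\subset\mathbb{R}^n$ and let $\mu\in M(\mathbb{R}^n)$ be a finite complex Borel measure whose spectrum (support of $\hat\mu$) lies in $A$. Suppose there is a $k$-dimensional linear subspace $V\subset\mathbb{R}^n$ such that for every $a\in\mathbb{R}^n$ the set $(V+a)\cap A$ is a Riesz set on $V+a$. Then $\mu(F)=0$ for every Borel set $F\subset\mathbb{R}^n$ with $\lambda_V(p_V(F))=0$.
   Context: A set $B\subset\mathbb{R}^d$ is a Riesz set if every finite Borel measure on $\mathbb{R}^d$ whose spectrum is contained in $B$ is absolutely continuous with respect to Lebesgue measure. A subset of an affine $k$-plane $V+a$ is called a Riesz set on $V+a$ if, after translating by $-a$ and identifying $V$ with $\mathbb{R}^k$ by a linear isometry, it is a Riesz set in $\mathbb{R}^k$. $p_V$ is the orthogonal projection onto $V$ and $\lambda_V$ is $k$-dimensional Lebesgue measure on $V$. *)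

(* Defs.v *)
From HB Require Import structures.
From mathcomp Require Import all_boot all_order all_algebra.
From mathcomp Require Import all_classical all_reals all_analysis.
Set Implicit Arguments. Unset Strict Implicit. Unset Printing Implicit Defensive.
Import Order.TTheory GRing.Theory Num.Theory.
Import numFieldNormedType.Exports.
Local Open Scope classical_set_scope.
Local Open Scope ring_scope.

Definition Rn (R : realType) (n : nat) := g_sigma_algebraType (@open 'rV[R]_n).

Definition dotv (R : realType) (n : nat) (x y : 'rV[R]_n) : R :=
  \sum_(i < n) x ord0 i * y ord0 i.

Definition box (R : realType) (k : nat) (a b : 'rV[R]_k) : set 'rV[R]_k :=
  [set x | forall j, a ord0 j <= x ord0 j <= b ord0 j].
Definition boxvol (R : realType) (k : nat) (a b : 'rV[R]_k) : R :=
  \prod_(j < k) Num.max (b ord0 j - a ord0 j) 0.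
Definition lebesgue_null (R : realType) (k : nat) (E : set 'rV[R]_k) : Prop :=
  forall eps : R, 0 < eps ->
    exists a b : nat -> 'rV[R]_k,
      E `<=` \bigcup_i box (a i) (b i) /\
      (\sum_(0 <= i <oo) (boxvol (a i) (b i))%:E < eps%:E)%E.

(* A finite complex Borel measure on R^n, given through (a Jordan-type
   decomposition into) four finite positive Borel measures:
   mu = (m1 - m2) + i (m3 - m4).  Every finite complex measure is of this form. *)
Record cmeasure (R : realType) (n : nat) := CMeasure {
  cm1 : {finite_measure set (Rn R n) -> \bar R};
  cm2 : {finite_measure set (Rn R n) -> \bar R};
  cm3 : {finite_measure set (Rn R n) -> \bar R};
  cm4 : {finite_measure set (Rn R n) -> \bar R} }.

Definition cm_re (R : realType) (n : nat) (mu : cmeasure R n) (F : set (Rn R n)) : R :=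
  fine (cm1 mu F) - fine (cm2 mu F).
Definition cm_im (R : realType) (n : nat) (mu : cmeasure R n) (F : set (Rn R n)) : R :=
  fine (cm3 mu F) - fine (cm4 mu F).

(* Fourier transform  mu^(xi) = \int exp(-2 pi i <x,xi>) dmu(x),
   real and imaginary parts. *)
Definition ftC (R : realType) (n : nat) (m : {finite_measure set (Rn R n) -> \bar R})
  (xi : 'rV[R]_n) : R :=
  Rintegral m setT (fun x : Rn R n => cos (2 * pi * dotv x xi)).
Definition ftS (R : realType) (n : nat) (m : {finite_measure set (Rn R n) -> \bar R})
  (xi : 'rV[R]_n) : R :=
  Rintegral m setT (fun x : Rn R n => sin (2 * pi * dotv x xi)).
Definition ft_re (R : realType) (n : nat) (mu : cmeasure R n) (xi : 'rV[R]_n) : R :=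
  ftC (cm1 mu) xi - ftC (cm2 mu) xi + ftS (cm3 mu) xi - ftS (cm4 mu) xi.
Definition ft_im (R : realType) (n : nat) (mu : cmeasure R n) (xi : 'rV[R]_n) : R :=
  - (ftS (cm1 mu) xi - ftS (cm2 mu) xi) + ftC (cm3 mu) xi - ftC (cm4 mu) xi.

Definition spectrum (R : realType) (n : nat) (mu : cmeasure R n) : set 'rV[R]_n :=
  closure [set xi | ft_re mu xi != 0 \/ ft_im mu xi != 0].

Definition abs_cont (R : realType) (n : nat) (mu : cmeasure R n) : Prop :=
  forall F : set (Rn R n), measurable F -> lebesgue_null F ->
    cm_re mu F = 0 /\ cm_im mu F = 0.

Definition Riesz_set (R : realType) (k : nat) (B : set 'rV[R]_k) : Prop :=
  forall mu : cmeasure R k, spectrum mu `<=` B -> abs_cont mu.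

(* Linear subspaces of R^n are row spaces of matrices V : 'M_n; a linear
   isometry R^k -> V (onto) is y |-> y *m P with P having orthonormal rows
   spanning V. *)
Definition isometry_onto (R : realType) (n k : nat) (V : 'M[R]_n) (P : 'M[R]_(k, n))
  : Prop := P *m P^T = 1%:M /\ (P == V)%MS.

Definition Riesz_set_on (R : realType) (n k : nat) (V : 'M[R]_n) (a : 'rV[R]_n)
  (B : set 'rV[R]_n) : Prop :=
  exists P : 'M[R]_(k, n), isometry_onto V P /\
    Riesz_set [set y : 'rV[R]_k | B (y *m P + a)].

Definition is_projV (R : realType) (n : nat) (V : 'M[R]_n) (x v : 'rV[R]_n) : Prop :=
  (v <= V)%MS /\ forall w : 'rV[R]_n, (w <= V)%MS -> dotv (x - v) w = 0.
Definition projV_set (R : realType) (n : nat) (V : 'M[R]_n) (F : set 'rV[R]_n)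
  : set 'rV[R]_n := [set v | exists2 x, F x & is_projV V x v].

(* lambda_V(E) = 0 for E subset of V : k-dimensional Lebesgue measure on V,
   transported by a linear isometry R^k -> V. *)
Definition lambdaV_null (R : realType) (n k : nat) (V : 'M[R]_n) (E : set 'rV[R]_n)
  : Prop :=
  exists P : 'M[R]_(k, n), isometry_onto V P /\
    lebesgue_null [set y : 'rV[R]_k | E (y *m P)].

(* Main.v *)
Require Import Defs.
From HB Require Import structures.
From mathcomp Require Import all_boot all_order all_algebra.
From mathcomp Require Import all_classical all_reals all_analysis.
From mathcomp Require Import measurable_realfun ring lra.
Import Order.TTheory GRing.Theory Num.Theory.
Import numFieldNormedType.Exports.
Local Open Scope classical_set_scope.
Local Open Scope ring_scope.

Set Implicit Arguments.
Unset Strict Implicit.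
Unset Printing Implicit Defensive.

(* For xi in R^n and orthonormal coordinates P on V, the image nu of
   e^{-2 pi i <x, xi>} mu under the projection x |-> x P^T has Fourier transform
   nu^(v) = mu^(v P + xi).  Its spectrum lies in the section of A by V + xi, so
   nu is absolutely continuous.  Hence, for a Borel null set N of V, the
   restriction of mu to the cylinder over N has vanishing Fourier transform and
   is zero by uniqueness.  Uniqueness is obtained by multiplying with trigonometric
   polynomials (1 - u^N)^(N 2^N), u = (1 - cos) / 2, which converge boundedly to
   indicators of the half-waves {cos > 0}; finite intersections of half-waves
   form a pi-system generating the Borel sets.  As the coordinates P may depend
   on xi, one also needs that linear maps preserve null sets. *)

(** * Finite measures with bounded densities *)

Section bounded_measurable.
Context d (T : measurableType d) (R : realType).
Implicit Types (f g : T -> R) (m : {finite_measure set T -> \bar R}).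

(** A class integrable against every finite measure and closed under products, so that integrability
    is never tracked measure by measure. *)
Definition bmeas f := measurable_fun setT f /\ exists M, forall x, `|f x| <= M.

Lemma bmeas_cst (r : R) : bmeas (fun=> r).
Proof. by split; [exact: measurable_cst | exists `|r|]. Qed.

Lemma bmeasD f g : bmeas f -> bmeas g -> bmeas (fun x => f x + g x).
Proof.
move=> [mf [M fM]] [mg [N gN]]; split; first exact: measurable_funD.
by exists (M + N) => x; rewrite (le_trans (ler_normD _ _))// lerD.
Qed.

Lemma bmeasM f g : bmeas f -> bmeas g -> bmeas (fun x => f x * g x).
Proof.
move=> [mf [M fM]] [mg [N gN]]; split; first exact: measurable_funM.
by exists (M * N) => x; rewrite normrM ler_pM.
Qed.

Lemma bmeasN f : bmeas f -> bmeas (fun x => - f x).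
Proof.
by move=> [mf [M fM]]; split; [exact: measurableT_comp | exists M => x; rewrite normrN].
Qed.

Lemma bmeasB f g : bmeas f -> bmeas g -> bmeas (fun x => f x - g x).
Proof. by move=> bf bg; apply: bmeasD => //; exact: bmeasN. Qed.

Lemma bmeas_exp f n : bmeas f -> bmeas (fun x => f x ^+ n).
Proof.
move=> bf; elim: n => [|n IHn]; first exact: bmeas_cst.
by under eq_fun do rewrite exprS; exact: bmeasM.
Qed.

Lemma bmeas_indic (A : set T) : measurable A -> bmeas (\1_A : T -> R).
Proof.
move=> mA; split => //; exists 1 => x.
by rewrite indicE; case: (x \in A); rewrite ?normr1 ?normr0.
Qed.

Lemma bmeas_integrable m f : bmeas f -> m.-integrable setT (EFin \o f).
Proof.
move=> [mf [M fM]]; apply: measurable_bounded_integrable => //.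
  by rewrite -ge0_fin_numE//; exact: fin_num_measure.
exists M; split; first exact: num_real.
by move=> N MN x _ /=; exact: le_trans (fM x) (ltW MN).
Qed.

Lemma bmeas_RintegralD m f g : bmeas f -> bmeas g ->
  Rintegral m setT (fun x => f x + g x) = Rintegral m setT f + Rintegral m setT g.
Proof. by move=> bf bg; rewrite RintegralD//; exact: bmeas_integrable. Qed.

Lemma bmeas_RintegralB m f g : bmeas f -> bmeas g ->
  Rintegral m setT (fun x => f x - g x) = Rintegral m setT f - Rintegral m setT g.
Proof. by move=> bf bg; rewrite RintegralB//; exact: bmeas_integrable. Qed.

Lemma bmeas_RintegralZ m r f : bmeas f ->
  Rintegral m setT (fun x => r * f x) = r * Rintegral m setT f.
Proof. by move=> bf; rewrite RintegralZl//; exact: bmeas_integrable. Qed.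

Lemma Rintegral_indicator m (A : set T) : measurable A ->
  Rintegral m setT (\1_A : T -> R) = fine (m A).
Proof. by move=> mA; rewrite /Rintegral integral_indic// setIT. Qed.

(** Since [m] is finite, the constant [M] is an integrable dominating function; the limit inherits
    measurability and the bound. *)
Lemma bmeas_dominated_cvg m (f_ : nat -> T -> R) f (M : R) :
  (forall n, measurable_fun setT (f_ n)) -> (forall n x, `|f_ n x| <= M) ->
  (forall x, f_ n x @[n --> \oo] --> f x) ->
  bmeas f /\ Rintegral m setT (f_ n) @[n --> \oo] --> Rintegral m setT f.
Proof.
move=> mf_ fM cf.
have mf : measurable_fun setT f.
  by apply: (measurable_fun_cvg mf_) => x _; exact: cf.
have bf : bmeas f.
  split=> //; exists M => x.
  have c : `|f_ n x| @[n --> \oo] --> `|f x| by apply: cvg_norm; exact: cf.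
  rewrite -(cvg_lim _ c)//; apply: limr_le; first by apply/cvg_ex; exists `|f x|.
  by apply: nearW => n; exact: fM.
split=> //.
have iM : m.-integrable setT (EFin \o (fun=> M)) by exact/bmeas_integrable/bmeas_cst.
have [] := @dominated_convergence _ T R m setT measurableT
  (fun n => EFin \o f_ n) (EFin \o f) (EFin \o (fun=> M)).
- by move=> n; exact/measurable_EFinP.
- exact/measurable_EFinP.
- by apply: aeW => x _ /=; apply: cvg_EFin; [exact: nearW | exact: cf].
- exact: iM.
- by apply: aeW => x n _ /=; rewrite lee_fin.
move=> _ _ c; apply: fine_cvg => /=.
by rewrite fineK//; exact: integrable_fin_num (bmeas_integrable _ bf).
Qed.

End bounded_measurable.

Lemma bmeas_comp d d' (X : measurableType d) (Y : measurableType d') (R : realType)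
    (g : Y -> R) (phi : X -> Y) :
  bmeas g -> measurable_fun setT phi -> bmeas (g \o phi).
Proof.
by move=> [mg [M gM]] mphi; split; [exact: measurableT_comp | exists M => x; exact: gM].
Qed.

Section density.
Context d (T : measurableType d) (R : realType).
Variables (m : {finite_measure set T -> \bar R}) (w : T -> R).
Hypotheses (bw : bmeas w) (w0 : forall x, 0 <= w x).

(* The proofs are arguments so that the measure instances can be attached to this head. *)
Definition density_measure (bw : bmeas w) (w0 : forall x, 0 <= w x) (A : set T) : \bar R :=
  (\int[m]_(x in A) (w x)%:E)%E.
Let nu := density_measure bw w0.

Let nu0 : nu set0 = 0%E.
Proof. by rewrite /nu /density_measure integral_set0. Qed.

Let nu_ge0 A : (0 <= nu A)%E.
Proof. by apply: integral_ge0 => /= x _; rewrite lee_fin. Qed.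

Let nu_sigma_additive : semi_sigma_additive nu.
Proof.
move=> /= F mF tF mUF; rewrite /nu /density_measure; apply: cvg_toP.
  apply: ereal_nondecreasing_is_cvgn => p q pq.
  apply: lee_sum_nneg_natr => // k _ _.
  by apply: integral_ge0 => /= x _; rewrite lee_fin.
rewrite ge0_integral_bigcup//=.
- by apply: measurable_funTS; apply/measurable_EFinP; case: bw.
- by move=> x _; rewrite lee_fin.
Qed.

HB.instance Definition _ := isMeasure.Build _ _ _ (density_measure bw w0)
  nu0 nu_ge0 nu_sigma_additive.

Let nu_fin : fin_num_fun (density_measure bw w0).
Proof.
move=> A mA; apply: integrable_fin_num => //.
by apply: (integrableS measurableT) => //; exact: bmeas_integrable.
Qed.

HB.instance Definition _ := @Measure_isFinite.Build _ _ _ (density_measure bw w0) nu_fin.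

End density.

Section density_integral.
Context d (T : measurableType d) (R : realType).
Variables (m : {finite_measure set T -> \bar R}) (w : T -> R).
Hypotheses (bw : bmeas w) (w0 : forall x, 0 <= w x).
Let nu : {finite_measure set T -> \bar R} := density_measure m bw w0.

Lemma density_measure_dominates : nu `<< m.
Proof.
apply/null_content_dominatesP => A mA mA0; apply: null_set_integral => //.
by apply: measurable_funTS; apply/measurable_EFinP; case: bw.
Qed.

(** Both functions have the same integral over every measurable set. This lets the change of
    variables for Radon-Nikodym derivatives be used with [w] itself. *)
Lemma ae_eq_density : ae_eq m setT (Radon_Nikodym_SigmaFinite.f nu m) (EFin \o w).
Proof.
have dom := density_measure_dominates.
apply: integral_ae_eq => //.
- exact: Radon_Nikodym_SigmaFinite.f_integrable.
- by apply/measurable_EFinP; case: bw.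
- by move=> E _ mE; rewrite -Radon_Nikodym_SigmaFinite.f_integral.
Qed.

Lemma ge0_integral_density (f : T -> \bar R) :
  (forall x, 0 <= f x)%E -> measurable_fun setT f ->
  (\int[nu]_x f x = \int[m]_x (f x * (w x)%:E))%E.
Proof.
move=> f0 mf; have dom := density_measure_dominates.
rewrite -(Radon_Nikodym_SigmaFinite.change_of_variables dom)//.
apply: ae_eq_integral => //.
- apply: emeasurable_funM => //; apply: measurable_int.
  exact: Radon_Nikodym_SigmaFinite.f_integrable.
- by apply: emeasurable_funM => //; apply/measurable_EFinP; case: bw.
- exact: (ae_eq_comp2 (fun x y => f x * y)%E ae_eq_density).
Qed.

Lemma Rintegral_density (g : T -> R) : bmeas g ->
  Rintegral nu setT g = Rintegral m setT (fun x => g x * w x).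
Proof.
move=> bg; have [mg [M gM]] := bg.
have ge0 (h : T -> R) : bmeas h -> (forall x, 0 <= h x) ->
    Rintegral nu setT h = Rintegral m setT (fun x => h x * w x).
  move=> [mh _] h0; rewrite /Rintegral ge0_integral_density//.
    exact/measurable_EFinP.
have M0 x : 0 <= M + g x.
  by rewrite -lerBlDl sub0r; have := gM x; rewrite ler_norml => /andP[].
have bM : bmeas (fun _ : T => M) by exact: bmeas_cst.
have bMg : bmeas (fun x => M + g x) by exact: bmeasD.
(* The signed case reduces to the nonnegative one by writing [g] as [(M + g) - M]. This needs
   [0 <= M], which follows from the bound only at an actual point of [T]. *)
case: (pselect (exists x : T, True)) => [[x0 _]|nT]; last first.
  have -> : [set: T] = set0 by apply/seteqP; split=> // x _; case: nT; exists x.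
  by rewrite !Rintegral_set0.
have M00 (x : T) : 0 <= M by rewrite (le_trans _ (gM x0)).
transitivity (Rintegral nu setT (fun x => (M + g x) - M)).
  by congr Rintegral; apply/funext => x; ring.
rewrite bmeas_RintegralB// ge0// ge0// -bmeas_RintegralB; [|exact: bmeasM..].
by congr Rintegral; apply/funext => x; ring.
Qed.

End density_integral.

(** The restriction to [setT] carries the bundled structure of a finite measure and does not change
    integrals. *)
Lemma finite_measure_of_measure d (T : measurableType d) (R : realType)
    (mu : {measure set T -> \bar R}) :
  fin_num_fun mu ->
  exists nu : {finite_measure set T -> \bar R}, 
    forall f : T -> \bar R, (\int[nu]_x f x = \int[mu]_x f x)%E.
Proof.
move=> fin; have muT : (mu setT < +oo)%E by rewrite -ge0_fin_numE//; exact: fin.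
exists (mfrestr measurableT muT) => f; apply: eq_measure_integral => A _ _.
by change (mu (A `&` setT) = mu A); rewrite setIT.
Qed.

(** [nu] is the image under [phi] of the measure with density [w] with respect to [m]. *)
Lemma finite_measure_weighted_pushforward d d' (X : measurableType d)
    (Y : measurableType d') (R : realType) (m : {finite_measure set X -> \bar R})
    (w : X -> R) (phi : X -> Y) :
  bmeas w -> (forall x, 0 <= w x) -> measurable_fun setT phi ->
  exists nu : {finite_measure set Y -> \bar R}, forall g : Y -> R, bmeas g ->
    Rintegral nu setT g = Rintegral m setT (fun x => g (phi x) * w x).
Proof.
move=> bw w0 mphi; pose dm : {finite_measure set X -> \bar R} := density_measure m bw w0.
have mpre A : measurable A -> measurable (phi @^-1` A).
  by move=> mA; rewrite -[X in measurable X]setTI; exact: mphi.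
pose pm := measure_function_pushforward__canonical__measure_function_Measure dm mphi.
have fin : fin_num_fun pm by move=> A mA; apply: (fin_num_measure dm); exact: mpre.
have [nu nuE] := finite_measure_of_measure fin.
exists nu => g bg.
have bgp : bmeas (g \o phi) by exact: bmeas_comp.
transitivity (Rintegral dm setT (g \o phi)); last exact: Rintegral_density.
rewrite /Rintegral nuE integral_pushforward//.
- by apply/measurable_EFinP; case: bg.
- exact: (bmeas_integrable _ bgp).
Qed.

Lemma finite_measure_sum d (T : measurableType d) (R : realType)
    (m1 m2 : {finite_measure set T -> \bar R}) :
  exists nu : {finite_measure set T -> \bar R}, forall g : T -> R, bmeas g ->
    Rintegral nu setT g = Rintegral m1 setT g + Rintegral m2 setT g.
Proof.
have fin : fin_num_fun (measure_add m1 m2).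
  by move=> A mA; rewrite measure_addE fin_numD !fin_num_measure.
have [nu nuE] := finite_measure_of_measure fin.
exists nu => g bg.
rewrite /Rintegral nuE integral_measure_add//; try exact: bmeas_integrable.
  by rewrite fineD//; exact: integrable_fin_num (bmeas_integrable _ bg).
Qed.

(** * Uniqueness of Fourier transforms *)

Section power_limits.
Context (R : realType).
Implicit Types (x y r u : R).

Lemma bernoulli_expr x n : -1 <= x -> 1 + n%:R * x <= (1 + x) ^+ n.
Proof.
move=> x1; elim: n => [|n IHn]; first by rewrite expr0 mul0r addr0.
rewrite exprS; apply: (@le_trans _ _ ((1 + x) * (1 + n%:R * x))).
  have : 0 <= n%:R * (x * x) by rewrite mulr_ge0// -expr2 sqr_ge0.
  by rewrite -natr1; nra.
by apply: ler_wpM2l => //; lra.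
Qed.

(** With [s = (1 + r) / 2] one has [r <= s ^+ 2], so the term is at most [(n s^n) s^n]. Writing
    [s = 1 / (1 + h)], Bernoulli's inequality bounds [n s^n] by [1 / h]. *)
Lemma cvg_natr_mul_expr r : 0 <= r -> r < 1 -> n%:R * r ^+ n @[n --> \oo] --> (0 : R).
Proof.
move=> r0 r1; pose s := (1 + r) / 2.
have s0 : 0 < s by rewrite /s; lra.
have s1 : s < 1 by rewrite /s; lra.
have rs : r <= s ^+ 2.
  have : 0 <= (1 - r) ^+ 2 by exact: sqr_ge0.
  by rewrite /s; nra.
pose h := s^-1 - 1; have h0 : 0 < h by rewrite /h subr_gt0 invf_gt1.
apply: (@squeeze_cvgr _ _ _ _ (fun=> 0) (fun n => h^-1 * s ^+ n)).
- apply: nearW => n; rewrite mulr_ge0 ?exprn_ge0//=.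
  have rsn : r ^+ n <= s ^+ n * s ^+ n.
    by rewrite -exprMn -expr2 lerXn2r// nnegrE// sqr_ge0.
  apply: (le_trans (ler_wpM2l (ler0n _ n) rsn)).
  rewrite mulrA; apply: ler_wpM2r; first by rewrite exprn_ge0// ltW.
  rewrite -[leRHS]div1r ler_pdivlMr//.
  have sn : s ^+ n = ((1 + h) ^+ n)^-1 by rewrite /h subrKC exprVn invrK.
  rewrite sn mulrAC ler_pdivrMr; last by rewrite exprn_gt0// addr_gt0.
  rewrite mul1r.
  have h1 : -1 <= h by lra.
  by apply: le_trans (bernoulli_expr n h1); lra.
- exact: cvg_cst.
- rewrite -[X in _ --> X](mulr0 h^-1); apply: cvgMr; apply: cvg_expr.
  by rewrite gtr0_norm.
Qed.

(* The exponents are tuned so that N 2^N u^N tends to 0 for u < 1/2 and to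
   infinity for u >= 1/2, the threshold value included. *)
Lemma cvg_half_indicator u : 0 <= u -> u <= 1 ->
  (1 - u ^+ n) ^+ (n * 2 ^ n) @[n --> \oo] --> ((u < 2^-1)%R%:R : R).
Proof.
move=> u0 u1.
have un0 n : 0 <= u ^+ n by rewrite exprn_ge0.
have un1 n : u ^+ n <= 1 by rewrite exprn_ile1.
have Mu n : (n * 2 ^ n)%:R * u ^+ n = n%:R * (2 * u) ^+ n.
  by rewrite natrM natrX exprMn mulrA.
have [uh|uh] := ltP u 2^-1.
  (* Bernoulli's inequality gives the lower bound, which tends to 1 because [2 * u < 1]. *)
  apply: (@squeeze_cvgr _ _ _ _ (fun n => 1 - n%:R * (2 * u) ^+ n) (fun=> 1)).
  - apply: nearW => n; rewrite exprn_ile1 ?andbT; [|by rewrite subr_ge0|by rewrite gerBl].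
    have := @bernoulli_expr (- u ^+ n) (n * 2 ^ n).
    by rewrite lerN2 un1 => /(_ isT); rewrite mulrN Mu.
  - rewrite -[X in _ --> X]subr0; apply: cvgB; first exact: cvg_cst.
    by apply: cvg_natr_mul_expr; lra.
  - exact: cvg_cst.
(* With [v = u^n] and [N = n 2^n], [(1 - v)^N (1 + v)^N <= 1] and [(1 + v)^N >= 1 + N v >= 1 + n],
   the last because [N v = n (2 u)^n] and [2 * u >= 1]. *)
apply: (@squeeze_cvgr _ _ _ _ (fun=> 0) harmonic).
- apply: nearW => n; rewrite exprn_ge0 ?subr_ge0//=.
  rewrite -[leRHS]div1r ler_pdivlMr ?ltr0Sn//.
  apply: (@le_trans _ _ ((1 - u ^+ n) ^+ (n * 2 ^ n) * (1 + u ^+ n) ^+ (n * 2 ^ n))).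
    rewrite ler_wpM2l ?exprn_ge0 ?subr_ge0//.
    have h1 : -1 <= u ^+ n by have := un0 n; lra.
    apply: le_trans (bernoulli_expr _ h1).
    rewrite Mu -natr1 addrC lerD2l ler_peMr// exprn_ege1//; lra.
  rewrite -exprMn exprn_ile1//.
    by have := un0 n; have := un1 n; nra.
  by have := un0 n; have := un1 n; nra.
- exact: cvg_cst.
- exact: cvg_harmonic.
Qed.

(** A single condition [cos > 0] is periodic, but if [|t| >= pi / 2] then some halving of [|t|] lies
    in [[pi / 2, pi)], where the cosine is not positive. Thus bounded slabs become countable
    intersections of half-waves. *)
Lemma cos_gt0_halvings (t : R) :
  (forall m, 0 < cos (t / 2 ^+ m)) <-> `|t| < pi / 2.
Proof.
split=> [ct|tp m]; last first.
  apply: cos_gt0_pihalf; rewrite -ltr_norml.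
  rewrite (le_lt_trans _ tp)// normrM [`|_^-1|]ger0_norm ?invr_ge0 ?exprn_ge0//.
  by rewrite ler_piMr// invf_le1 ?exprn_gt0// exprn_ege1// ler1n.
rewrite ltNge; apply/negP => tp.
have pi0 := pi_gt0 R.
have [m [tm1 tm2]] : exists m, pi / 2 <= `|t| / 2 ^+ m /\ `|t| / 2 ^+ m < pi.
  have exm : exists m, `|t| / 2 ^+ m < pi.
    have /cvgr_lt/(_ pi) : `|t| * 2^-1 ^+ n @[n --> \oo] --> (0 : R).
      rewrite -[X in _ --> X](mulr0 `|t|); apply: cvgMr; apply: cvg_expr.
      by rewrite ger0_norm; lra.
    move=> /(_ pi0)[N _ /(_ N (leqnn _))]; rewrite /= exprVn => ?; by exists N.
  (* The least [m] with [|t| / 2^m < pi] works: by minimality the preceding halving is at least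
     [pi], so this one is at least [pi / 2]; for [m = 0] the lower bound is the assumption on
     [t]. *)
  case: (ex_minnP exm) => -[|m] mp mmin; first by exists 0%N; rewrite expr0 divr1 in mp *.
  exists m.+1; split=> //.
  have h : pi <= `|t| / 2 ^+ m by rewrite leNgt; apply/negP => /mmin; rewrite ltnn.
  rewrite exprS invfM mulrCA [leRHS]mulrC.
  by rewrite ler_wpM2r.
have := ct m; apply/negP; rewrite -leNgt.
have -> : cos (t / 2 ^+ m) = cos (`|t| / 2 ^+ m).
  have [//|t0] := leP 0 t; first by move=> t0; rewrite ger0_norm.
  by rewrite ltr0_norm// mulNr cosN.
rewrite -[X in cos X](subrK (pi / 2)) cosDpihalf oppr_le0 sin_ge0_pi//.
by rewrite subr_ge0 tm1/=; lra.
Qed.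

End power_limits.

(** * Borel sets and continuous maps on spaces of row vectors *)

Section borel_row_vectors.
Context (R : realType).

Lemma measurable_open_Rn n (A : set 'rV[R]_n) : open A -> measurable (A : set (Rn R n)).
Proof. by move=> oA; exact: sub_sigma_algebra. Qed.

Lemma measurable_fun_Rn n (f : 'rV[R]_n -> R) :
  continuous f -> measurable_fun (setT : set (Rn R n)) (f : Rn R n -> R).
Proof.
move=> /continuousP cf; apply: (measurability _ (RGenOpens.measurableE R)).
move=> _ [_ [a [b ->] <-]]; rewrite setTI; apply: measurable_open_Rn.
exact/cf/interval_open.
Qed.

Lemma continuous_sum_rV n (I : Type) (r : seq I) (F : I -> 'rV[R]_n -> R) :
  (forall i, continuous (F i)) -> continuous (fun x => \sum_(i <- r) F i x).
Proof.
move=> cF x; elim: r => [|i r IHr].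
  have -> : (fun y => \sum_(i <- [::]) F i y) = fun=> 0.
    by apply/funext => y; rewrite big_nil.
  exact: cst_continuous.
have -> : (fun y => \sum_(j <- i :: r) F j y) = fun y => F i y + \sum_(j <- r) F j y.
  by apply/funext => y; rewrite big_cons.
exact: (continuousD (cF i x) IHr).
Qed.

Lemma continuous_dotv n (xi : 'rV[R]_n) : continuous (fun x => dotv x xi).
Proof.
apply: continuous_sum_rV => i x; apply: continuousM; last exact: cst_continuous.
exact: coord_continuous.
Qed.

Lemma continuous_rowP n k (f : 'rV[R]_n -> 'rV[R]_k) :
  (forall j, continuous (fun x => f x ord0 j)) -> continuous f.
Proof.
move=> cf x A [P Px PA].
have Pf : \forall y \near nbhs x, forall j : 'I_k, P ord0 j (f y ord0 j).
  apply: (@filter_forall 'rV[R]_n _ (fun j y => P ord0 j (f y ord0 j)) (nbhs x) _) => j.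
  exact: (cf j x _ (Px ord0 j)).
by apply: (@filterS _ (nbhs x) _ _ _ _ Pf) => y Py; apply: PA => i j; rewrite (ord1 i).
Qed.

Lemma continuous_mulmxr n k (M : 'M[R]_(n, k)) :
  continuous (fun x : 'rV[R]_n => x *m M).
Proof.
apply: continuous_rowP => j.
have -> : (fun x : 'rV[R]_n => (x *m M) ord0 j) = fun x => \sum_i x ord0 i * M i j.
  by apply/funext => x; rewrite mxE.
apply: continuous_sum_rV => i x; apply: continuousM; last exact: cst_continuous.
exact: coord_continuous.
Qed.

Lemma measurable_mulmxr n k (M : 'M[R]_(n, k)) :
  measurable_fun (setT : set (Rn R n)) (fun x : Rn R n => (x : 'rV[R]_n) *m M : Rn R k).
Proof.
apply: (@measurability _ _ _ (Rn R k) setT _ (@open 'rV[R]_k) (erefl _)) => //.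
move=> _ [A oA <-]; rewrite setTI; apply: measurable_open_Rn.
by move/continuousP: (@continuous_mulmxr _ _ M); exact.
Qed.

Lemma measurable_box k (a b : 'rV[R]_k) : measurable (box a b : set (Rn R k)).
Proof.
have -> : box a b = \bigcap_(j in [set: 'I_k]) (fun x : Rn R k => (x : 'rV[R]_k) ord0 j) @^-1` `[a ord0 j, b ord0 j].
  apply/seteqP; split=> x /= xab j; first by move=> _ /=; rewrite in_itv/=; exact: xab.
  by have := xab j I; rewrite /= in_itv.
apply: fin_bigcap_measurable => // j _; rewrite -[X in measurable X]setTI.
by apply: measurable_fun_Rn => //; exact: coord_continuous.
Qed.

End borel_row_vectors.

(** * Multipliers that preserve equality of Fourier transforms *)

Section fourier_uniqueness.
Context (R : realType) (n : nat) (m1 m2 : {finite_measure set (Rn R n) -> \bar R}).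
Implicit Types (g h : Rn R n -> R) (xi : 'rV[R]_n) (th r c : R).

(** The phase [th] puts sines and cosines into one family, whose linear span is closed under
    products by [wave_mul]. *)
Definition wave xi th : Rn R n -> R := fun x => cos (2 * pi * dotv x xi + th).

Lemma bmeas_wave xi th : bmeas (wave xi th).
Proof.
split; last by exists 1 => x; exact: cos_max.
apply: measurableT_comp; first exact: (continuous_measurable_fun (@continuous_cos R)).
apply: measurable_funD => //; apply: measurable_funM => //.
by apply: measurable_fun_Rn; exact: continuous_dotv.
Qed.

Lemma wave_mul xi eta th ph x :
  wave eta ph x * wave xi th x =
  2^-1 * (wave (xi + eta) (th + ph) x + wave (xi - eta) (th - ph) x).
Proof.
have dD : dotv x (xi + eta) = dotv x xi + dotv x eta.
  by rewrite /dotv -big_split; apply: eq_bigr => i _; rewrite mxE mulrDr.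
have dB : dotv x (xi - eta) = dotv x xi - dotv x eta.
  by rewrite /dotv -sumrB; apply: eq_bigr => i _; rewrite !mxE mulrBr.
rewrite /wave dD dB.
have -> : 2 * pi * (dotv x xi + dotv x eta) + (th + ph) =
  (2 * pi * dotv x xi + th) + (2 * pi * dotv x eta + ph) by ring.
have -> : 2 * pi * (dotv x xi - dotv x eta) + (th - ph) =
  (2 * pi * dotv x xi + th) - (2 * pi * dotv x eta + ph) by ring.
have prod (a b : R) : cos b * cos a = 2^-1 * (cos (a + b) + cos (a - b)).
  by rewrite cosD cosB; field.
exact: prod.
Qed.

(** Expresses that [g m1] and [g m2] have the same Fourier transform, without forming these possibly
    signed measures. *)
Definition same_fourier g := bmeas g /\ forall xi th,
  Rintegral m1 setT (fun x => g x * wave xi th x) =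
  Rintegral m2 setT (fun x => g x * wave xi th x).

(** The quantification over [g] makes multipliers compose, so they are closed under products and
    their indicators under intersections. *)
Definition multiplier h := forall g, same_fourier g -> same_fourier (fun x => g x * h x).

Lemma multiplier_cst r : multiplier (fun=> r).
Proof.
move=> g [bg gE]; have br : bmeas (fun _ : Rn R n => r) by exact: bmeas_cst.
split=> [|xi th]; first exact: bmeasM.
have -> : (fun x => g x * r * wave xi th x) = fun x => r * (g x * wave xi th x).
  by apply/funext => x; ring.
have bw := bmeasM bg (bmeas_wave xi th).
by rewrite !bmeas_RintegralZ// gE.
Qed.

Lemma multiplierB h1 h2 : multiplier h1 -> multiplier h2 -> multiplier (fun x => h1 x - h2 x).
Proof.
move=> mh1 mh2 g gE; have [b1 e1] := mh1 _ gE; have [b2 e2] := mh2 _ gE.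
have -> : (fun x => g x * (h1 x - h2 x)) = fun x => g x * h1 x - g x * h2 x.
  by apply/funext => x; rewrite mulrBr.
split=> [|xi th]; first exact: bmeasB.
under eq_Rintegral do rewrite mulrBl; under [RHS]eq_Rintegral do rewrite mulrBl.
have bw := bmeas_wave xi th.
by rewrite !bmeas_RintegralB ?e1 ?e2//; exact: bmeasM.
Qed.

Lemma multiplierM h1 h2 : multiplier h1 -> multiplier h2 -> multiplier (fun x => h1 x * h2 x).
Proof.
move=> mh1 mh2 g /mh1/mh2.
by have -> : (fun x => g x * (h1 x * h2 x)) = fun x => g x * h1 x * h2 x
  by apply/funext => x; rewrite mulrA.
Qed.

Lemma multiplier_exp h k : multiplier h -> multiplier (fun x => h x ^+ k).
Proof.
move=> mh; elim: k => [|k IHk].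
  by have -> : (fun x => h x ^+ 0) = fun=> 1; [exact/funext | exact: multiplier_cst].
have -> : (fun x => h x ^+ k.+1) = fun x => h x * h x ^+ k.
  by apply/funext => x; rewrite exprS.
exact: multiplierM.
Qed.

(** Multiplication by a wave only shifts frequency and phase, and [same_fourier] holds for all of
    these. *)
Lemma multiplier_wave eta ph : multiplier (wave eta ph).
Proof.
move=> g [bg gE]; split=> [|xi th]; first exact/bmeasM/bmeas_wave.
have -> : (fun x => g x * wave eta ph x * wave xi th x) =
    fun x => 2^-1 * (g x * wave (xi + eta) (th + ph) x + g x * wave (xi - eta) (th - ph) x).
  by apply/funext => x; rewrite -mulrA wave_mul; ring.
have b1 := bmeasM bg (bmeas_wave (xi + eta) (th + ph)).
have b2 := bmeasM bg (bmeas_wave (xi - eta) (th - ph)).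
rewrite !bmeas_RintegralZ; [|exact: bmeasD..].
by rewrite !bmeas_RintegralD// !gE.
Qed.

(** Dominated convergence applies to both measures; the two sequences of integrals coincide, hence
    so do their limits. *)
Lemma multiplier_cvg (h_ : nat -> Rn R n -> R) h :
  (forall k, multiplier (h_ k)) -> (forall k, measurable_fun setT (h_ k)) ->
  (forall k x, `|h_ k x| <= 1) -> (forall x, h_ k x @[k --> \oo] --> h x) ->
  multiplier h.
Proof.
move=> mh mm h1 ch g gE; have [[mg [M gM]] _] := gE.
have lim xi th (m : {finite_measure set (Rn R n) -> \bar R}) :
    bmeas (fun x => g x * h x) /\ 
    Rintegral m setT (fun x => g x * h_ k x * wave xi th x) @[k --> \oo] -->
    Rintegral m setT (fun x => g x * h x * wave xi th x).
  have [mw _] := bmeas_wave xi th; split.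
    have [] // := @bmeas_dominated_cvg _ _ _ m (fun k x => g x * h_ k x) (fun x => g x * h x) M.
    - by move=> k; exact: measurable_funM.
    - by move=> k x; rewrite normrM -[leRHS]mulr1 ler_pM.
    - by move=> x; apply: cvgMr; exact: ch.
  have [] // := @bmeas_dominated_cvg _ _ _ m (fun k x => g x * h_ k x * wave xi th x)
    (fun x => g x * h x * wave xi th x) M.
  - by move=> k; do 2?[apply: measurable_funM => //].
  - move=> k x; rewrite !normrM -[leRHS]mulr1 ler_pM//; last exact: cos_max.
    by rewrite -[leRHS]mulr1 ler_pM.
  - by move=> x; apply: cvgMl; apply: cvgMr; exact: ch.
split=> [|xi th]; first by have [] := lim 0 0 m1.
have [_ l1] := lim xi th m1; have [_ l2] := lim xi th m2.
move: l1; rewrite (_ : (fun k => _) =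
    fun k => Rintegral m2 setT (fun x => g x * h_ k x * wave xi th x)); last first.
  by apply/funext => k; have [_] := mh k _ gE; exact.
by move=> l1; exact: (cvg_unique _ l1 l2).
Qed.

Lemma multiplier_halfwave xi th : multiplier (\1_[set x | 0 < wave xi th x]).
Proof.
(* This normalization has values in [[0, 1]] and is below [1 / 2] exactly where the wave is
   positive, as [cvg_half_indicator] requires. *)
pose u x := (1 - wave xi th x) * 2^-1.
have mu : multiplier u.
  apply: multiplierM; last exact: multiplier_cst.
  by apply: multiplierB; [exact: multiplier_cst | exact: multiplier_wave].
have bu : bmeas u.
  by apply: bmeasM; [apply: bmeasB; [exact: bmeas_cst | exact: bmeas_wave] | exact: bmeas_cst].
have u0 x : 0 <= u x by have := cos_le1 (2 * pi * dotv x xi + th); rewrite /u /wave; lra.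
have u1 x : u x <= 1 by have := cos_geN1 (2 * pi * dotv x xi + th); rewrite /u /wave; lra.
apply: (@multiplier_cvg (fun k x => (1 - u x ^+ k) ^+ (k * 2 ^ k))).
- move=> k; apply: multiplier_exp; apply: multiplierB; first exact: multiplier_cst.
  exact: multiplier_exp.
- move=> k; suff [] : bmeas (fun x => (1 - u x ^+ k) ^+ (k * 2 ^ k)) by [].
  by apply: bmeas_exp; apply: bmeasB; [exact: bmeas_cst | exact: bmeas_exp].
- move=> k x.
  have a0 : 0 <= 1 - u x ^+ k by rewrite subr_ge0 exprn_ile1.
  by rewrite ger0_norm ?exprn_ge0// exprn_ile1// gerBl exprn_ge0.
- move=> x; have -> : \1_[set x | 0 < wave xi th x] x = (u x < 2^-1)%R%:R :> R.
    rewrite indicE; congr (nat_of_bool _)%:R; rewrite /u.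
    by apply/idP/idP; rewrite inE /=; lra.
  exact: cvg_half_indicator.
Qed.

Definition multiplier_sets : set (set (Rn R n)) :=
  [set A | measurable A /\ multiplier (\1_A)].

Lemma multiplier_sets_slab (j : 'I_n) c r : 0 < r ->
  multiplier_sets.-sigma.-measurable [set x : 'rV[R]_n | `|x ord0 j - c| < r].
Proof.
move=> r0; pose t (x : 'rV[R]_n) := pi * (x ord0 j - c) / (2 * r).
(* The slab is [|t| < pi / 2]; frequency and phase are chosen so that the wave equals
   [cos (t x / 2 ^+ m)], which makes [cos_gt0_halvings] applicable. *)
pose xi m : 'rV[R]_n := (4 * r * 2 ^+ m)^-1 *: delta_mx ord0 j.
pose th m : R := - (pi * c / (2 * r)) / 2 ^+ m.
have -> : [set x : 'rV[R]_n | `|x ord0 j - c| < r] =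
    \bigcap_m [set x | 0 < wave (xi m) (th m) x].
  have wE m x : wave (xi m) (th m) x = cos (t x / 2 ^+ m).
    rewrite /wave; congr cos.
    have -> : dotv x (xi m) = x ord0 j / (4 * r * 2 ^+ m).
      rewrite /dotv (bigD1 j)//= big1 => [|i ij]; rewrite !mxE eqxx/=.
        by rewrite eqxx mulr1 addr0.
      by rewrite (negbTE ij) !mulr0.
    rewrite /th /t; field.
    by rewrite expf_neq0//= gt_eqF.
  have rE (x : 'rV[R]_n) : (`|x ord0 j - c| < r) = (`|t x| < pi / 2).
    have pi0 := pi_gt0 R.
    rewrite /t !normrM (gtr0_norm pi0) [`|_^-1|]gtr0_norm ?invr_gt0 ?mulr_gt0//.
    rewrite ltr_pdivrMr ?mulr_gt0// [X in _ = (_ < X)](_ : _ = pi * r); last by field.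
    by rewrite ltr_pM2l.
  apply/seteqP; split=> x /=.
    by rewrite rE => /cos_gt0_halvings tx m _ /=; rewrite wE.
  by move=> xm; rewrite rE; apply/cos_gt0_halvings => m; rewrite -wE; exact: xm.
apply: bigcapT_measurable => m; apply: sub_sigma_algebra; split.
  rewrite -[X in measurable X]setTI.
  rewrite [X in _ `&` X](_ : _ = wave (xi m) (th m) @^-1` `]0, +oo[); last first.
    by apply/seteqP; split=> x /=; rewrite in_itv/= andbT.
  by have [mw _] := bmeas_wave (xi m) (th m); exact: mw.
exact: multiplier_halfwave.
Qed.

Lemma multiplier_sets_open (U : set 'rV[R]_n) : open U ->
  multiplier_sets.-sigma.-measurable U.
Proof.
move=> oU.
pose B (q : 'rV[rat]_n * nat) := [set x : 'rV[R]_n | forall j,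
  `|x ord0 j - ratr (q.1 ord0 j)| < q.2.+1%:R^-1].
have mB q : multiplier_sets.-sigma.-measurable (B q).
  have -> : B q = \bigcap_(j in [set: 'I_n]) [set x : 'rV[R]_n |
      `|x ord0 j - ratr (q.1 ord0 j)| < q.2.+1%:R^-1].
    by apply/seteqP; split=> x /= xB j; [move=> _; exact: xB | exact: (xB j I)].
  by apply: fin_bigcap_measurable => // j _; exact: multiplier_sets_slab.
(* [U] is the union of the rational cubes inside it; replacing the others by [set0] keeps the index
   type countable. *)
have -> : U = \bigcup_q (if `[< B q `<=` U >] then B q else set0).
  apply/seteqP; split=> [x Ux|x [q _]]; last by case: asboolP => // BU; exact: BU.
  have /nbhs_ballP[e /= e0 eU] : nbhs x U by exact: open_nbhs_nbhs.
  (* Half the radius suffices: [x] and any [y] in the cube are both closer than [e / 2] to its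
     rational center in each coordinate. *)
  have e20 : 0 < e / 2 by rewrite divr_gt0.
  have [N _ /(_ N (leqnn _)) /= Ne] := near_infty_natSinv_lt (PosNum e20).
  have exq j : {q : rat | `|x ord0 j - ratr q| < N.+1%:R^-1}.
    apply: cid; have : x ord0 j - N.+1%:R^-1 < x ord0 j + N.+1%:R^-1.
      by rewrite ltrD2l gtrN// invr_gt0 ltr0Sn.
    move=> /rat_in_itvoo[q]; rewrite in_itv/= => /andP[q1 q2].
    have aux (a b d : R) : a - d < b -> b < a + d -> `|a - b| < d.
      by move=> h1 h2; rewrite ltr_norml; apply/andP; split; lra.
    by exists q; exact: aux.
  exists (\row_j sval (exq j), N) => //.
  have xB : B (\row_j sval (exq j), N) x.
    by move=> j /=; rewrite mxE; case: (exq j).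
  case: asboolP => // -[] y yB; apply: eU; split=> // i j; rewrite (ord1 i).
  have := xB j; have := yB j; rewrite /= mxE /ball/= => yj xj.
  rewrite [X in `|X|](_ : _ = (x ord0 j - ratr (sval (exq j))) -
    (y ord0 j - ratr (sval (exq j)))); last by ring.
  rewrite (le_lt_trans (ler_normB _ _))// (splitr e) ltrD//; first exact: lt_trans Ne.
  exact: lt_trans Ne.
apply: countable_bigcupT_measurable => [|q]; first exact: countableP.
by case: asboolP.
Qed.

(** The multiplier sets form a pi-system generating the Borel sets, so it suffices to compare the
    restrictions of [m1] and [m2] to [S] on them. *)
Theorem fourier_uniqueness (S A : set (Rn R n)) :
  measurable S -> same_fourier (\1_S) -> measurable A ->
  fine (m1 (A `&` S)) = fine (m2 (A `&` S)).
Proof.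
move=> mS sS mA.
have mG : @measurable _ (Rn R n) = <<s multiplier_sets >>.
  apply/seteqP; split.
    apply: smallest_sub; first exact: smallest_sigma_algebra.
    exact: multiplier_sets_open.
  apply: smallest_sub; first exact: sigma_algebra_measurable.
  by move=> B [].
have indicM (B C : set (Rn R n)) : (\1_(B `&` C) : Rn R n -> R) = fun x => \1_B x * \1_C x.
  by apply/funext => x; rewrite indicI.
rewrite -[m1 _]/(mrestr m1 mS A) -[m2 _]/(mrestr m2 mS A).
congr fine; apply: (measure_unique multiplier_sets (fun=> setT) mG) => //.
- move=> B C [mB muB] [mC muC]; split; first exact: measurableI.
  by rewrite indicM; exact: multiplierM.
- by move=> _; split => //; rewrite indicT; exact: multiplier_cst.
- by rewrite bigcup_const.
- move=> B [mB muB].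
  have mBS : measurable (B `&` S) by exact: measurableI.
  have fE (m : {finite_measure set (Rn R n) -> \bar R}) :
    m (B `&` S) = (fine (m (B `&` S)))%:E by rewrite fineK// fin_num_measure.
  change (m1 (B `&` S) = m2 (B `&` S)); rewrite fE [RHS]fE.
  congr EFin; rewrite -!Rintegral_indicator//.
  (* At frequency and phase zero the wave is 1, and equality of Fourier transforms becomes equality
     of masses. *)
  have [_ /(_ 0 0)] := muB _ sS.
  have w1 : wave 0 0 = fun=> 1.
    apply/funext => x; rewrite /wave /dotv big1 ?mulr0 ?addr0 ?cos0// => i _.
    by rewrite mxE mulr0.
  have -> : (fun x => \1_S x * \1_B x * wave 0 0 x) = \1_(B `&` S).
    by rewrite indicM w1; apply/funext => x; rewrite mulr1 mulrC.
  by [].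
- move=> _; change (m1 (setT `&` S) < +oo)%E.
  by rewrite setTI -ge0_fin_numE// fin_num_measure.
Qed.

End fourier_uniqueness.

(** * Null sets and linear maps *)

(** Merges a sequence of covers into one: surjectivity of [f] loses no box, and nonnegative terms
    may be summed in any order. *)
Lemma nneseries_pairs (R : realType) (v : nat -> nat -> \bar R) :
  (forall i j, 0 <= v i j)%E ->
  exists f : nat -> nat * nat, (forall p, exists n, f n = p) /\
    (\sum_(0 <= n <oo) v (f n).1 (f n).2 =
     \sum_(0 <= i <oo) \sum_(0 <= j <oo) v i j)%E.
Proof.
move=> v0; have /card_esym/ppcard_eqP[f] := card_nat2.
exists f; split; first by move=> p; exists (f^-1%FUN p); rewrite invK ?inE.
rewrite nneseries_esumT// [RHS]nneseries_esumT; last by move=> i; exact: nneseries_ge0.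
under [RHS]eq_esum do rewrite nneseries_esumT//.
rewrite esum_esum//.
have -> : [set: nat] `*`` (fun=> [set: nat]) = [set: nat * nat].
  by apply/seteqP; split.
by rewrite (@reindex_esum _ _ _ setT setT f (fun p => v p.1 p.2)).
Qed.

Section null_sets.
Context (R : realType).

(** The cubes form a grid of mesh [d] based at [a]. An axis of length [l] needs at most [l / d + 1]
    of them, which accounts for the factor [l + d]. *)
Lemma box_cubes k (a b : 'rV[R]_k) (d : R) : 0 < d ->
  exists s : seq 'rV[R]_k,
    (forall x, box a b x -> exists2 c, c \in s &
       forall j, c ord0 j <= x ord0 j <= c ord0 j + d) /\
    (size s)%:R * d ^+ k <= \prod_(j < k) (Num.max (b ord0 j - a ord0 j) 0 + d).
Proof.
move=> d0; pose l j := Num.max (b ord0 j - a ord0 j) 0.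
have l0 j : 0 <= l j by rewrite le_max lexx orbT.
have ld0 j : 0 <= l j / d by rewrite divr_ge0// ltW.
pose m j := Num.truncn (l j / d).
pose M := (\sum_(j < k) m j)%N.
have mM j : (m j <= M)%N by rewrite /M (bigD1 j)//= leq_addr.
pose Fam (j : 'I_k) : pred 'I_M.+1 := fun i => (i <= m j)%N.
exists [seq (\row_j (a ord0 j + (f j : 'I_M.+1)%:R * d)) | f : {ffun 'I_k -> 'I_M.+1} in family Fam].
split=> [x xab|].
  have xa j : 0 <= (x ord0 j - a ord0 j) / d.
    by rewrite divr_ge0 ?(ltW d0)// subr_ge0; have /andP[] := xab j.
  pose i j := Num.truncn ((x ord0 j - a ord0 j) / d).
  have im j : (i j <= m j)%N.
    apply: le_truncn; apply: ler_wpM2r; first by rewrite invr_ge0 ltW.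
    by rewrite le_max lerD2r; have /andP[_ ->] := xab j.
  have iM j : (i j < M.+1)%N by rewrite ltnS (leq_trans (im j)).
  exists (\row_j (a ord0 j + (i j)%:R * d)).
    apply/fintype.imageP; exists [ffun j => Ordinal (iM j)].
      by apply/familyP => j; rewrite ffunE; exact: im.
    by apply/rowP => j; rewrite !mxE ffunE.
  move=> j; rewrite mxE; have /andP[] := truncn_itv (xa j); rewrite -/(i j).
  rewrite ler_pdivlMr// ltr_pdivrMr// -natr1 mulrDl mul1r => h1 h2.
  by apply/andP; split; lra.
rewrite size_image card_family foldrE big_image/= natr_prod.
rewrite -[in d ^+ k](card_ord k) -prodr_const -big_split/=.
apply: ler_prod => j _; rewrite mulr_ge0 ?ler0n ?(ltW d0)//=.
have cF : (#|Fam j| <= (m j).+1)%N.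
  rewrite -sum1_card (eq_bigl (fun i : 'I_M.+1 => (i <= m j)%N))//.
  by rewrite (big_ord_narrow_leq (mM j)) sum1_card card_ord.
apply: (@le_trans _ _ ((m j).+1%:R * d)); first by rewrite ler_pM2r// ler_nat.
rewrite -natr1 mulrDl mul1r lerD2r -ler_pdivlMr//.
by have /andP[] := truncn_itv (ld0 j).
Qed.

(** The product is a polynomial in [d], hence continuous at 0. *)
Lemma prod_perturbation k (l : 'I_k -> R) (eta : R) : 0 < eta ->
  exists2 d, 0 < d & \prod_j (l j + d) <= \prod_j l j + eta.
Proof.
move=> eta0; pose p : {poly R} := \prod_j ('X + (l j)%:P).
have pE d : p.[d] = \prod_j (l j + d).
  by rewrite horner_prod; apply: eq_bigr => j _; rewrite !hornerE addrC.
have /cvgr_lt/(_ (p.[0] + eta)) := @continuous_horner _ p 0.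
rewrite ltrDl => /(_ eta0) /nbhs_ballP[e /= e0 eP].
exists (e / 2); first by rewrite divr_gt0.
have : p.[e / 2] < p.[0] + eta.
  apply: eP; rewrite /ball /= sub0r normrN gtr0_norm ?divr_gt0//; lra.
rewrite !pE => /ltW; under [in X in _ <= X -> _]eq_bigr do rewrite addr0.
by [].
Qed.

(** The box is first cut into small cubes: the image of a cube of side [d] fits into a cube of side
    [2 K d], whereas the image of an elongated box may fit into no box of comparable volume. The
    term [eta] absorbs the excess of the grid, also for boxes of volume zero. *)
Lemma linear_image_box k (L : 'M[R]_k) : exists2 C, 0 < C &
  forall (a b : 'rV[R]_k) (eta : R), 0 < eta ->
  exists s : seq ('rV[R]_k * 'rV[R]_k),
    (forall x, box a b x -> exists2 q, q \in s & box q.1 q.2 (x *m L)) /\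
    \sum_(q <- s) boxvol q.1 q.2 <= C * (boxvol a b + eta).
Proof.
(* [K] bounds every column sum of absolute values; the summand 1 keeps it positive even for
   [L = 0]. *)
pose K := 1 + \sum_i \sum_j `|L i j|.
have K0 : 0 < K by rewrite ltr_pwDl// sumr_ge0// => i _; rewrite sumr_ge0.
exists ((2 * K) ^+ k); first by rewrite exprn_gt0// mulr_gt0.
move=> a b eta eta0.
have [d d0 dP] := prod_perturbation (fun j => Num.max (b ord0 j - a ord0 j) 0) eta0.
have [s [sP sS]] := box_cubes a b d0.
pose rad : 'rV[R]_k := const_mx (d * K).
exists [seq (c *m L - rad, c *m L + rad) | c <- s]; split.
  move=> x /sP[c cs cx]; exists (c *m L - rad, c *m L + rad).
    by apply/mapP; exists c.
  move=> j; rewrite /= !mxE -ler_distl -sumrB.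
  apply: (le_trans (ler_norm_sum _ _ _)).
  apply: (@le_trans _ _ (\sum_i d * `|L i j|)).
    apply: ler_sum => i _; rewrite -mulrBl normrM ler_wpM2r//.
    by have /andP[h1 h2] := cx i; rewrite ger0_norm ?subr_ge0//; lra.
  rewrite -mulr_sumr ler_pM2l// /K -[leLHS]add0r lerD// ler_sum// => i _.
  by rewrite (bigD1 j)//= lerDl sumr_ge0.
have volc c : boxvol (c *m L - rad) (c *m L + rad) = (2 * K) ^+ k * d ^+ k.
  rewrite -exprMn -[in RHS](card_ord k) -prodr_const; apply: eq_bigr => j _.
  rewrite !mxE (_ : _ - _ = 2 * K * d); last by ring.
  by rewrite max_l// !mulr_ge0// ltW.
rewrite big_map/=; under eq_bigr do rewrite volc.
rewrite big_const_seq count_predT iter_addr_0 -[_ *+ size s]mulr_natl mulrCA.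
rewrite ler_pM2l ?exprn_gt0 ?mulr_gt0//.
exact: le_trans sS dP.
Qed.

Lemma lebesgue_null_linear k (L : 'M[R]_k) (E : set 'rV[R]_k) : (0 < k)%N ->
  lebesgue_null E -> lebesgue_null [set x *m L | x in E].
Proof.
move=> k0 nE eps eps0; have [C C0 CP] := linear_image_box L.
(* The cover of [E] costs less than [e] and the grid errors [e / 2 ^ i.+1] at most [e] in total;
   multiplied by [C], this stays below [eps]. *)
pose e := eps / (2 * C); have e0 : 0 < e by rewrite divr_gt0// mulr_gt0.
have [a [b [Eab abe]]] := nE _ e0.
have vol0 (p q : 'rV[R]_k) : 0 <= boxvol p q.
  by apply: prodr_ge0 => j _; rewrite le_max lexx orbT.
have et0 i : 0 < e / (2 ^ i.+1)%:R by rewrite divr_gt0// ltr0n expn_gt0.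
have /choice[s sP] : forall i, exists s : seq ('rV[R]_k * 'rV[R]_k),
    (forall x, box (a i) (b i) x -> exists2 q, q \in s & box q.1 q.2 (x *m L)) /\
    \sum_(q <- s) boxvol q.1 q.2 <= C * (boxvol (a i) (b i) + e / (2 ^ i.+1)%:R).
  by move=> i; exact: CP.
(* Beyond the end of [s i] the default is the one-point box at 0, of volume zero because [0 < k], so
   the padded series equals the finite sum. *)
pose G i j := nth (0, 0) (s i) j.
pose v i j := (boxvol (G i j).1 (G i j).2)%:E.
have v0 i j : (0 <= v i j)%E by rewrite lee_fin.
have [f [fsurj fsum]] := nneseries_pairs v0.
exists (fun n => (G (f n).1 (f n).2).1), (fun n => (G (f n).1 (f n).2).2); split.
  move=> _ [x Ex <-]; have [i _ xi] := Eab _ Ex.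
  have [q qs qx] := (sP i).1 _ xi.
  have [N fN] := fsurj (i, index q (s i)).
  by exists N => //; rewrite fN/= /G nth_index.
rewrite (_ : limn _ = \sum_(0 <= i <oo) \sum_(0 <= j <oo) v i j)%E; last exact: fsum.
have vs i : (\sum_(0 <= j <oo) v i j <= C%:E * ((boxvol (a i) (b i))%:E + (e / (2 ^ i.+1)%:R)%:E))%E.
  have -> : (\sum_(0 <= j <oo) v i j = (\sum_(q <- s i) boxvol q.1 q.2)%:E)%E.
    apply: lim_near_cst => //; near=> N.
    have sN : (size (s i) <= N)%N by near: N; exact: nbhs_infty_ge.
    rewrite (big_cat_nat (leq0n _) sN)/= [X in (_ + X)%E]big1_seq ?adde0; last first.
      move=> j; rewrite mem_index_iota => /and3P[_ sj _].
      rewrite /v /G nth_default// /boxvol/=; congr EFin.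
      rewrite (bigD1 (Ordinal k0))//= !mxE subrr maxxx mul0r //.
    by rewrite sumEFin (big_nth (0, 0)).
  by rewrite -EFinD -EFinM lee_fin; exact: (sP i).2.
apply: (@le_lt_trans _ _ (\sum_(0 <= i <oo) (C%:E * ((boxvol (a i) (b i))%:E + (e / (2 ^ i.+1)%:R)%:E))))%E.
  by apply: lee_nneseries => // i _ _; exact: nneseries_ge0.
rewrite nneseriesZl; last by move=> i _; rewrite adde_ge0// lee_fin// ltW.
apply: (@le_lt_trans _ _ (C%:E * (\sum_(0 <= i <oo) (boxvol (a i) (b i))%:E + e%:E)))%E.
  rewrite lee_pmul2l ?lte_fin//; apply: epsilon_trick; last exact: ltW.
  by move=> i; rewrite lee_fin.
have -> : eps = C * (e + e) by rewrite /e; field; rewrite gt_eqF.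
by rewrite [X in (_ < X)%E]EFinM lte_pmul2l ?lte_fin// EFinD lteD2rE.
Unshelve. all: by end_near. Qed.

(** In dimension zero every box has volume 1, the empty product, so no cover has total volume below
    1. *)
Lemma not_lebesgue_null0 (E : set 'rV[R]_0) : ~ lebesgue_null E.
Proof.
move=> /(_ 1 ltr01)[a [b [_]]]; apply/negP; rewrite -leNgt.
apply: (@le_trans _ _ (\sum_(0 <= i < 1) (boxvol (a i) (b i))%:E)%E).
  by rewrite big_nat1 /boxvol big_ord0.
by apply: nneseries_lim_ge => i _; rewrite lee_fin /boxvol big_ord0.
Qed.

(** The projection of a Borel set need not be Borel. The intersection of box covers of volume below
    [1 / (m + 1)] is a Borel null set containing it. *)
Lemma lebesgue_null_cover k (E : set 'rV[R]_k) : lebesgue_null E ->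
  exists N : set 'rV[R]_k,
    [/\ measurable (N : set (Rn R k)), E `<=` N & lebesgue_null N].
Proof.
move=> nE; have d0 m : 0 < m.+1%:R^-1 :> R by rewrite invr_gt0 ltr0Sn.
have /choice[ab abP] m : exists ab : (nat -> 'rV[R]_k) * (nat -> 'rV[R]_k),
    E `<=` \bigcup_i box (ab.1 i) (ab.2 i) /\
    (\sum_(0 <= i <oo) (boxvol (ab.1 i) (ab.2 i))%:E < m.+1%:R^-1%:E)%E.
  by have [a [b h]] := nE _ (d0 m); exists (a, b).
exists (\bigcap_m \bigcup_i box ((ab m).1 i) ((ab m).2 i)); split.
- apply: bigcapT_measurable => m; apply: bigcupT_measurable => i.
  exact: measurable_box.
- by move=> x Ex m _; exact: (abP m).1.
- move=> eps eps0; have [m _ /(_ m (leqnn _)) /= me] := near_infty_natSinv_lt (PosNum eps0).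
  exists (ab m).1, (ab m).2; split; first by move=> x; exact.
  by apply: (lt_trans (abP m).2); rewrite lte_fin.
Qed.

End null_sets.

(** * Modulated projections *)

Section trigonometric_moments.
Context (R : realType) (n : nat).
Implicit Types (xi : 'rV[R]_n) (x : Rn R n).

Definition cosw xi : Rn R n -> R := fun x => cos (2 * pi * dotv x xi).
Definition sinw xi : Rn R n -> R := fun x => sin (2 * pi * dotv x xi).

Let measurable_phase xi : measurable_fun setT (fun x : Rn R n => 2 * pi * dotv x xi).
Proof. by apply: measurable_funM => //; apply: measurable_fun_Rn; exact: continuous_dotv. Qed.

Lemma bmeas_cosw xi : bmeas (cosw xi).
Proof.
split; last by exists 1 => x; exact: cos_max.
exact: measurableT_comp (continuous_measurable_fun (@continuous_cos R)) (measurable_phase xi).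
Qed.

Lemma bmeas_sinw xi : bmeas (sinw xi).
Proof.
split; last by exists 1 => x; exact: sin_max.
exact: measurableT_comp (continuous_measurable_fun (@continuous_sin R)) (measurable_phase xi).
Qed.

Lemma dotvE (x y : 'rV[R]_n) : dotv x y = (x *m y^T) ord0 ord0.
Proof. by rewrite mxE; apply: eq_bigr => i _; rewrite mxE. Qed.

Lemma dotvD (x y z : 'rV[R]_n) : dotv x (y + z) = dotv x y + dotv x z.
Proof. by rewrite !dotvE linearD mulmxDr mxE. Qed.

Lemma dotvN (x y : 'rV[R]_n) : dotv x (- y) = - dotv x y.
Proof. by rewrite !dotvE linearN mulmxN mxE. Qed.

Lemma coswN xi : cosw (- xi) = cosw xi.
Proof. by apply/funext => x; rewrite /cosw dotvN mulrN cosN. Qed.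

Lemma sinwN xi : sinw (- xi) = fun x => -1 * sinw xi x.
Proof. by apply/funext => x; rewrite /sinw dotvN mulrN sinN mulN1r. Qed.

Lemma coswD xi eta x : cosw (xi + eta) x = cosw xi x * cosw eta x - sinw xi x * sinw eta x.
Proof. by rewrite /cosw dotvD mulrDr cosD. Qed.

Lemma sinwD xi eta x : sinw (xi + eta) x = sinw xi x * cosw eta x + cosw xi x * sinw eta x.
Proof. by rewrite /sinw dotvD mulrDr sinD. Qed.

Lemma same_fourier_cosw_sinw (m1 m2 : {finite_measure set (Rn R n) -> \bar R})
    (g : Rn R n -> R) : bmeas g ->
  (forall xi, Rintegral m1 setT (fun x => g x * cosw xi x) =
              Rintegral m2 setT (fun x => g x * cosw xi x)) ->
  (forall xi, Rintegral m1 setT (fun x => g x * sinw xi x) =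
              Rintegral m2 setT (fun x => g x * sinw xi x)) ->
  same_fourier m1 m2 g.
Proof.
move=> bg gc gs; split=> // xi th.
have bc := bmeasM bg (bmeas_cosw xi); have bs := bmeasM bg (bmeas_sinw xi).
have -> : (fun x => g x * wave xi th x) =
    fun x => cos th * (g x * cosw xi x) - sin th * (g x * sinw xi x).
  by apply/funext => x; rewrite /wave cosD /cosw /sinw; ring.
rewrite !bmeas_RintegralB ?bmeas_RintegralZ ?gc ?gs//;
  by apply: bmeasM => //; exact: bmeas_cst.
Qed.

End trigonometric_moments.

Section modulated_projection.
Context (R : realType) (n k : nat) (phi : Rn R n -> Rn R k).
Hypothesis mphi : measurable_fun setT phi.

(** Integration against a finite signed measure, kept as a difference of two positive ones to match
    the components of [cmeasure]. *)
Definition signed_functional (L : (Rn R k -> R) -> R) :=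
  exists p q : {finite_measure set (Rn R k) -> \bar R}, forall g, bmeas g ->
    Rintegral p setT g - Rintegral q setT g = L g.

Lemma signed_functionalN L : signed_functional L -> signed_functional (fun g => - L g).
Proof. by move=> [p [q pq]]; exists q, p => g bg; rewrite -pq// opprB. Qed.

Lemma signed_functionalD L1 L2 : signed_functional L1 -> signed_functional L2 ->
  signed_functional (fun g => L1 g + L2 g).
Proof.
move=> [p1 [q1 e1]] [p2 [q2 e2]].
have [p pE] := finite_measure_sum p1 p2; have [q qE] := finite_measure_sum q1 q2.
by exists p, q => g bg; rewrite pE// qE// -e1// -e2//; ring.
Qed.

(** The weight is split as [(|M| + w) - |M|], and both nonnegative parts are pushed forward. *)
Lemma signed_functional_pushforward (m : {finite_measure set (Rn R n) -> \bar R})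
    (w : Rn R n -> R) : bmeas w ->
  signed_functional (fun g => Rintegral m setT (fun x => g (phi x) * w x)).
Proof.
move=> bw; have [mw [M wM]] := bw.
have bM : bmeas (fun _ : Rn R n => `|M|) by exact: bmeas_cst.
have bMw : bmeas (fun x => `|M| + w x) by exact: bmeasD.
have Mw0 x : 0 <= `|M| + w x.
  by have := le_trans (wM x) (ler_norm M); rewrite ler_norml => /andP[]; lra.
have [p pE] := finite_measure_weighted_pushforward m bMw Mw0 mphi.
have [q qE] := finite_measure_weighted_pushforward m bM (fun=> normr_ge0 M) mphi.
exists p, q => g bg; have bgp := bmeas_comp bg mphi.
rewrite pE// qE// -bmeas_RintegralB; [|exact: bmeasM..].
by congr Rintegral; apply/funext => x; ring.
Qed.

(* The image under phi of e^{-2 pi i <x, xi>} mu. *)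
Lemma modulated_pushforward (mu : cmeasure R n) (xi : 'rV[R]_n) :
  exists nu : cmeasure R k, forall g, bmeas g ->
    let I m w := Rintegral m setT (fun x => g (phi x) * w x) in
    Rintegral (cm1 nu) setT g - Rintegral (cm2 nu) setT g =
      I (cm1 mu) (cosw xi) - I (cm2 mu) (cosw xi) +
      I (cm3 mu) (sinw xi) - I (cm4 mu) (sinw xi) /\
    Rintegral (cm3 nu) setT g - Rintegral (cm4 nu) setT g =
      I (cm3 mu) (cosw xi) - I (cm4 mu) (cosw xi) -
      I (cm1 mu) (sinw xi) + I (cm2 mu) (sinw xi).
Proof.
have C m := signed_functional_pushforward m (bmeas_cosw xi).
have S m := signed_functional_pushforward m (bmeas_sinw xi).
(* With [a = m1 - m2] and [b = m3 - m4], the product of [cos - i sin] and [a + i b] has real part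
   [a cos + b sin] and imaginary part [b cos - a sin]. *)
have [p1 [p2 re]] := signed_functionalD (signed_functionalD (signed_functionalD
  (C (cm1 mu)) (signed_functionalN (C (cm2 mu)))) (S (cm3 mu))) (signed_functionalN (S (cm4 mu))).
have [p3 [p4 im]] := signed_functionalD (signed_functionalD (signed_functionalD
  (C (cm3 mu)) (signed_functionalN (C (cm4 mu)))) (signed_functionalN (S (cm1 mu)))) (S (cm2 mu)).
exists (CMeasure p1 p2 p3 p4) => g bg I.
by split; [exact: re | exact: im].
Qed.

End modulated_projection.

Section orthonormal_rows.
Context (R : realType) (n k : nat) (V : 'M[R]_n).

(** [P^T *m P] is the orthogonal projection onto [V], so it fixes the rows of [Q], which lie in
    [V]. *)
Lemma isometry_onto_proj (P Q : 'M[R]_(k, n)) :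
  isometry_onto V P -> isometry_onto V Q -> Q *m P^T *m P = Q.
Proof.
move=> [PP /andP[_ VP]] [_ /andP[QV _]].
have /submxP[D ->] := submx_trans QV VP.
by rewrite -!mulmxA (mulmxA P) PP mul1mx.
Qed.

Lemma isometry_onto_is_projV (P : 'M[R]_(k, n)) (x : 'rV[R]_n) :
  isometry_onto V P -> is_projV V x (x *m P^T *m P).
Proof.
move=> [PP /andP[PV VP]]; split; first exact: submx_trans (submxMl _ _) PV.
move=> w wV; have /submxP[d ->] := submx_trans wV VP.
rewrite dotvE trmx_mul mulmxA mulmxBl -(mulmxA (x *m P^T)) PP mulmx1.
by rewrite subrr mul0mx mxE.
Qed.

End orthonormal_rows.

(** * Fourier transform and spectrum of the projected measure *)

Section spectrum_of_projection.
Context (R : realType) (n k : nat) (P : 'M[R]_(k, n)) (mu : cmeasure R n).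
Variables (xi : 'rV[R]_n) (nu : cmeasure R k).
Let phi : Rn R n -> Rn R k := fun x => (x : 'rV[R]_n) *m P^T.
Let I (g : Rn R k -> R) m w := Rintegral m setT (fun x => g (phi x) * w x).
Hypothesis nuE : forall g, bmeas g ->
  Rintegral (cm1 nu) setT g - Rintegral (cm2 nu) setT g =
    I g (cm1 mu) (cosw xi) - I g (cm2 mu) (cosw xi) +
    I g (cm3 mu) (sinw xi) - I g (cm4 mu) (sinw xi) /\
  Rintegral (cm3 nu) setT g - Rintegral (cm4 nu) setT g =
    I g (cm3 mu) (cosw xi) - I g (cm4 mu) (cosw xi) -
    I g (cm1 mu) (sinw xi) + I g (cm2 mu) (sinw xi).

Let dotv_phi (x : 'rV[R]_n) v : dotv (phi x) v = dotv x (v *m P).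
Proof. by rewrite !dotvE /phi trmx_mul mulmxA. Qed.

Let ftC_shift m v :
  ftC m (v *m P + xi) = I (cosw v) m (cosw xi) - I (sinw v) m (sinw xi).
Proof.
rewrite /I -bmeas_RintegralB; last 2 first.
- by apply: bmeasM (bmeas_cosw xi); apply: bmeas_comp (bmeas_cosw v) _; exact: measurable_mulmxr.
- by apply: bmeasM (bmeas_sinw xi); apply: bmeas_comp (bmeas_sinw v) _; exact: measurable_mulmxr.
congr Rintegral; apply/funext => x; rewrite -/(cosw _ _) coswD.
by rewrite /cosw /sinw dotv_phi.
Qed.

Let ftS_shift m v :
  ftS m (v *m P + xi) = I (sinw v) m (cosw xi) + I (cosw v) m (sinw xi).
Proof.
rewrite /I -bmeas_RintegralD; last 2 first.
- by apply: bmeasM (bmeas_cosw xi); apply: bmeas_comp (bmeas_sinw v) _; exact: measurable_mulmxr.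
- by apply: bmeasM (bmeas_sinw xi); apply: bmeas_comp (bmeas_cosw v) _; exact: measurable_mulmxr.
congr Rintegral; apply/funext => x; rewrite -/(sinw _ _) sinwD.
by rewrite /cosw /sinw dotv_phi.
Qed.

Lemma ft_modulated_pushforward v :
  ft_re nu v = ft_re mu (v *m P + xi) /\ ft_im nu v = ft_im mu (v *m P + xi).
Proof.
have [cr ci] := nuE (bmeas_cosw v); have [sr si] := nuE (bmeas_sinw v).
rewrite /ft_re /ft_im !ftC_shift !ftS_shift.
rewrite -[ftC (cm1 nu) v]/(Rintegral _ _ (cosw v)) -[ftC (cm2 nu) v]/(Rintegral _ _ (cosw v)).
rewrite -[ftC (cm3 nu) v]/(Rintegral _ _ (cosw v)) -[ftC (cm4 nu) v]/(Rintegral _ _ (cosw v)).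
rewrite -[ftS (cm1 nu) v]/(Rintegral _ _ (sinw v)) -[ftS (cm2 nu) v]/(Rintegral _ _ (sinw v)).
rewrite -[ftS (cm3 nu) v]/(Rintegral _ _ (sinw v)) -[ftS (cm4 nu) v]/(Rintegral _ _ (sinw v)).
by split; lra.
Qed.

(** The continuous map [v |-> v *m P + xi] sends points where the transform of [nu] is nonzero to
    such points for [mu], hence closure into closure. *)
Lemma spectrum_modulated_pushforward v :
  spectrum nu v -> spectrum mu (v *m P + xi).
Proof.
move=> nuv B Bv.
have cont : continuous (fun y : 'rV[R]_k => y *m P + xi).
  apply: continuous_rowP => j.
  have -> : (fun y : 'rV[R]_k => (y *m P + xi) ord0 j) =
      (fun y : 'rV[R]_k => (y *m P) ord0 j) \+ (fun=> xi ord0 j).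
    by apply/funext => y; rewrite mxE.
  move=> y; apply: continuousD; last exact: cst_continuous.
  exact: (@continuous_comp _ _ _ (fun y : 'rV[R]_k => y *m P) (fun z => z ord0 j) y
    (@continuous_mulmxr _ _ _ P y) (@coord_continuous R _ _ ord0 j (y *m P))).
have [y [/= ny By]] := nuv _ (cont v _ Bv).
have [er ei] := ft_modulated_pushforward y.
by exists (y *m P + xi); split => //=; rewrite -er -ei.
Qed.

End spectrum_of_projection.

(** * Vanishing of the measure on cylinders over null sets *)

Section null_projection.
Context (R : realType) (n k : nat) (mu : cmeasure R n) (V : 'M[R]_n) (P0 : 'M[R]_(k, n)).
Variables (A : set 'rV[R]_n) (N : set 'rV[R]_k).
Hypotheses (k0 : (0 < k)%N) (isoP0 : isometry_onto V P0) (specA : spectrum mu `<=` A).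
Hypothesis rieszA : forall a : 'rV[R]_n,
  Riesz_set_on k V a [set x | A x /\ exists2 v, (v <= V)%MS & x = v + a].
Hypotheses (mN : measurable (N : set (Rn R k))) (nullN : lebesgue_null N).

Let S : set (Rn R n) := [set x | N ((x : 'rV[R]_n) *m P0^T)].
Let I (m : {finite_measure set (Rn R n) -> \bar R}) (w : Rn R n -> R) :=
  Rintegral m setT (fun x => \1_S x * w x).

Lemma measurable_cylinder : measurable S.
Proof. by rewrite -[X in measurable X]setTI; exact: (measurable_mulmxr P0^T). Qed.

(** The two expressions are the real and imaginary parts of the Fourier transform at [xi] of [mu]
    restricted to [S]. They equal those of [nu] on a null set, where [nu] is the absolutely
    continuous projected measure. *)
Lemma cylinder_modulated_mass xi :
  I (cm1 mu) (cosw xi) - I (cm2 mu) (cosw xi) + I (cm3 mu) (sinw xi) - I (cm4 mu) (sinw xi) = 0 /\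
  I (cm3 mu) (cosw xi) - I (cm4 mu) (cosw xi) - I (cm1 mu) (sinw xi) + I (cm2 mu) (sinw xi) = 0.
Proof.
have [P [isoP rieszP]] := rieszA xi.
have [nu nuE] := modulated_pushforward (measurable_mulmxr P^T) mu xi.
have ac : abs_cont nu.
  apply: rieszP => v /(spectrum_modulated_pushforward nuE) sv; split; first exact: specA.
  exists (v *m P) => //; case: isoP => _ /andP[PV _].
  exact: submx_trans (submxMl _ _) PV.
(* N read in the coordinates given by P instead of P0 *)
pose E : set 'rV[R]_k := [set y | N (y *m (P *m P0^T))].
have mE : measurable (E : set (Rn R k)).
  by rewrite -[X in measurable X]setTI; exact: (measurable_mulmxr (P *m P0^T)).
(* [P *m P0^T] is inverted by [P0 *m P^T], so [E] lies in the linear image of [N] under the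
   latter. *)
have nullE : lebesgue_null E.
  move=> eps /(lebesgue_null_linear (P0 *m P^T) k0 nullN)[a [b [Nab abeps]]].
  exists a, b; split=> // y Ey; apply: Nab; exists (y *m (P *m P0^T)) => //.
  have PP : P *m P0^T *m (P0 *m P^T) = 1%:M.
    by rewrite mulmxA (isometry_onto_proj isoP0 isoP); case: isoP.
  by rewrite -mulmxA PP mulmx1.
(* The cylinder is the same in both coordinates: transposing [P0 *m P^T *m P = P0] gives
   [P^T *m P *m P0^T = P0^T]. *)
have ES (x : Rn R n) : \1_E ((x : 'rV[R]_n) *m P^T) = \1_S x :> R.
  have SE : E ((x : 'rV[R]_n) *m P^T) = S x.
    rewrite /E /S /= -mulmxA (mulmxA P^T); congr N; congr (x *m _).
    by rewrite -[RHS](congr1 trmx (isometry_onto_proj isoP isoP0)) !trmx_mul trmxK mulmxA.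
  by rewrite !indicE; congr (nat_of_bool _)%:R; apply/idP/idP; rewrite !inE SE.
have [er ei] := nuE _ (bmeas_indic R mE); have [cr ci] := ac _ mE nullE.
have IE (m : {finite_measure set (Rn R n) -> \bar R}) (w : Rn R n -> R) :
  Rintegral m setT (fun x : Rn R n => \1_E ((x : 'rV[R]_n) *m P^T) * w x) = I m w.
  by congr Rintegral; apply/funext => x; rewrite ES.
move: er ei; rewrite !IE !Rintegral_indicator// => <- <-.
by split; [exact: cr | exact: ci].
Qed.

(* Replacing xi by -xi separates the cosine and sine parts. *)
Lemma same_fourier_cylinder :
  same_fourier (cm1 mu) (cm2 mu) (\1_S) /\ same_fourier (cm3 mu) (cm4 mu) (\1_S).
Proof.
have bS := bmeas_indic R measurable_cylinder.
have IN m xi : I m (sinw (- xi)) = - I m (sinw xi).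
  rewrite /I sinwN -[RHS]mulN1r -(bmeas_RintegralZ m (-1) (bmeasM bS (bmeas_sinw xi))).
  by congr Rintegral; apply/funext => x; ring.
have key xi : [/\ I (cm1 mu) (cosw xi) = I (cm2 mu) (cosw xi),
    I (cm3 mu) (cosw xi) = I (cm4 mu) (cosw xi),
    I (cm1 mu) (sinw xi) = I (cm2 mu) (sinw xi) &
    I (cm3 mu) (sinw xi) = I (cm4 mu) (sinw xi)].
  have [e1 e2] := cylinder_modulated_mass xi.
  have [e3 e4] := cylinder_modulated_mass (- xi).
  by move: e3 e4; rewrite coswN !IN => e3 e4; split; lra.
by split; apply: same_fourier_cosw_sinw => // xi; have [] := key xi.
Qed.

Lemma cylinder_null (F : set (Rn R n)) : measurable F -> F `<=` S ->
  cm_re mu F = 0 /\ cm_im mu F = 0.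
Proof.
move=> mF FS; have [s12 s34] := same_fourier_cylinder; have mS := measurable_cylinder.
have := fourier_uniqueness mS s12 mF; have := fourier_uniqueness mS s34 mF.
by rewrite /cm_re /cm_im setIidl// => -> ->; rewrite !subrr.
Qed.

End null_projection.

Theorem mainTheorem9 (R : realType) (n k : nat) (A : set 'rV[R]_n)
  (mu : cmeasure R n) (V : 'M[R]_n) :
  spectrum mu `<=` A ->
  \rank V = k ->
  (forall a : 'rV[R]_n,
     Riesz_set_on k V a [set x | A x /\ exists2 v, (v <= V)%MS & x = v + a]) ->
  forall F : set (Rn R n), measurable F ->
    lambdaV_null k V (projV_set V F) ->
    cm_re mu F = 0 /\ cm_im mu F = 0.
Proof.
move=> specA _ rieszA F mF [P0 [isoP0 nullE]].
(* For [k = 0] the null set hypothesis is contradictory; positive dimension is needed for linear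
   images of null sets. *)
have [k0|k0] := posnP k; first by subst k; case: (not_lebesgue_null0 nullE).
have [N [mN EN nullN]] := lebesgue_null_cover nullE.
(* [F] lies in the cylinder over [N], since [x *m P0^T] is the coordinate vector of the projection
   of [x] to [V]. *)
apply: (cylinder_null k0 isoP0 specA rieszA mN nullN mF) => x Fx.
by apply: EN; exists x => //; exact: isometry_onto_is_projV.
Qed.
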